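(* Let $P$ be a pattern without empty columns, let $P'$ be derived from $P$ by adding empty columns, and let $m_0$ be a fixed positive integer. If $\operatorname{sat}(m_0,n,P)=O(1)$, then $\operatorname{sat}(m_0,n,P')=O(1)$ (both as $n\to\infty$).
   Context: All matrices are 0-1 matrices; a pattern is a 0-1 matrix. A column is empty if it contains no ones. A matrix $M$ contains $P$ if some submatrix of $M$ (obtained by deleting rows and columns) can be turned into $P$ by changing some number (possibly zero) of its ones to zeroes. The weight is the number of $1$ entries. $M$ is $P$-saturated if $M$ does not contain $P$, but changing any $0$ entry of $M$ to a $1$ yields a matrix containing $P$. $\operatorname{sat}(m,n,P)$ is the minimum weight of an $m\times n$ $P$-saturated matrix. Asymptotic notation is for $n\to\infty$ with $m_0$ and the pattern fixed. *)

(* Defs.v *)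
From mathcomp Require Import all_boot all_algebra.

Set Implicit Arguments.
Unset Strict Implicit.
Unset Printing Implicit Defensive.

(* A 0-1 matrix is a boolean matrix, [true] standing for 1. *)

Definition increasing (a b : nat) (f : {ffun 'I_a -> 'I_b}) : bool :=
  [forall i : 'I_a, forall j : 'I_a, (i < j) ==> (f i < f j)].

(* Deleting rows and columns of [M] amounts to keeping the rows in the image
   of an increasing [f] and the columns in the image of an increasing [g]. *)
Definition contains (m n k l : nat) (M : 'M[bool]_(m, n)) (P : 'M[bool]_(k, l))
    : bool :=
  [exists f : {ffun 'I_k -> 'I_m}, exists g : {ffun 'I_l -> 'I_n},
    [&& increasing f, increasing g &
        [forall i, forall j, P i j ==> mxsub f g M i j]]].

Definition set_one (m n : nat) (M : 'M[bool]_(m, n)) (i : 'I_m) (j : 'I_n)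
    : 'M[bool]_(m, n) :=
  \matrix_(i', j') (((i', j') == (i, j)) || M i' j').

Definition weight (m n : nat) (M : 'M[bool]_(m, n)) : nat :=
  #|[set ij : 'I_m * 'I_n | M ij.1 ij.2]|.

Definition saturated (m n k l : nat) (P : 'M[bool]_(k, l))
    (M : 'M[bool]_(m, n)) : bool :=
  ~~ contains M P &&
  [forall i, forall j, ~~ M i j ==> contains (set_one M i j) P].

(* The weight of an m x n matrix is at most m * n, so the default value
   (m * n).+1 is returned only when there is no saturated matrix; this does not
   happen when [P] has a 1 (lemmas [sat_attained] and [saturated_exists]). *)
Definition sat (m n k l : nat) (P : 'M[bool]_(k, l)) : nat :=
  \big[minn/(m * n).+1]_(M : 'M[bool]_(m, n) | saturated P M) weight M.

Definition empty_col (k l : nat) (P : 'M[bool]_(k, l)) (j : 'I_l) : bool :=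
  [forall i, ~~ P i j].

Definition adds_empty_cols (k l l' : nat) (P : 'M[bool]_(k, l))
    (P' : 'M[bool]_(k, l')) : Prop :=
  exists g : {ffun 'I_l -> 'I_l'},
    [/\ increasing g, colsub g P' = P &
        forall j, j \notin codom g -> empty_col P' j].

(* u(n) = O(1) as n tends to infinity. *)
Definition bigO1 (u : nat -> nat) : Prop :=
  exists C N : nat, forall n, N <= n -> u n <= C.

Lemma weight_le (m n : nat) (M : 'M[bool]_(m, n)) : weight M <= m * n.
Proof. by rewrite (leq_trans (max_card _)) // card_prod !card_ord. Qed.

Lemma sat_le (m n k l : nat) (P : 'M[bool]_(k, l)) (M : 'M[bool]_(m, n)) :
  saturated P M -> sat m n P <= weight M.
Proof.
move=> sM; rewrite /sat; elim: index_enum (mem_index_enum M) => // N s IHs.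
rewrite inE big_cons => /predU1P[<-|/IHs le_s]; first by rewrite sM geq_minl.
by case: ifP => // _; rewrite geq_min le_s orbT.
Qed.

Lemma sat_attained (m n k l : nat) (P : 'M[bool]_(k, l)) (M : 'M[bool]_(m, n)) :
  saturated P M ->
  exists2 M0 : 'M[bool]_(m, n), saturated P M0 & weight M0 = sat m n P.
Proof.
move=> sM; case: (arg_minnP (@weight m n) sM) => M0 sM0 minM0.
exists M0 => //; apply/eqP; rewrite eqn_leq sat_le // andbT.
rewrite /sat; elim/big_ind: _ => [|x y Hx Hy|N /minM0 //].
  exact: leq_trans (weight_le _) (leqnSn _).
by rewrite leq_min Hx.
Qed.

Lemma saturated_exists (m n k l : nat) (P : 'M[bool]_(k, l)) :
  (exists i j, P i j) -> exists M : 'M[bool]_(m, n), saturated P M.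
Proof.
move=> [i [j Pij]].
have c0 : ~~ contains (const_mx false : 'M[bool]_(m, n)) P.
  apply/existsP => -[f /existsP[g /and3P[_ _ /forallP/(_ i)/forallP/(_ j)]]].
  by rewrite Pij !mxE.
have [M cM maxM] :=
  @arg_maxnP _ _ (fun M : 'M[bool]_(m, n) => ~~ contains M P) (@weight m n) c0.
exists M; rewrite /saturated cM /=; apply/forallP => a; apply/forallP => b.
apply/implyP => Mab; apply: contraT => /maxM; rewrite /= leqNgt => /negP[].
apply: proper_card; apply/properP; split.
  by apply/subsetP => ij; rewrite !inE mxE => ->; rewrite orbT.
by exists (a, b); rewrite inE ?mxE ?eqxx.
Qed.

(* Main.v *)
Require Import Defs.
From mathcomp Require Import all_boot all_algebra.
From mathcomp Require Import zify.

Set Implicit Arguments.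
Unset Strict Implicit.
Unset Printing Implicit Defensive.

(** The empty columns of [P'] demand nothing of the columns that they are
    matched with: a copy of [P'] in a matrix is a copy of [P] whose columns are
    far enough from each other and from the two borders. Conversely, empty
    columns of a matrix are invisible to [P], which has none.

    Bounded saturation gives a [P]-saturated matrix [M] of fixed width that has
    more columns than ones, hence an empty column [c]; every new one in column
    [c] of [M] creates a copy of [P]. Move the columns of [M] apart, inserting
    empty columns between them and at the borders, at least as many as [P'] has
    columns, and let all the remaining width of the wide matrix be empty columns
    around [c]. The result avoids [P'], because it avoids [P]
    ([spread_contains]), and column [c] may be thought of as sitting anywhere in
    the long empty stretch ([eq_spread]), so a new one there creates a copy of
    [P] with wide gaps, that is, a copy of [P'] ([contains_spread]). The
    number of columns outside this stretch depends on [M] and [P'] only, not on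
    the width.

    Nothing is known of those few other columns, but it does not matter: a
    maximal [P']-free matrix above the constructed one is saturated and can have
    ones in these columns only, so its weight is bounded ([sat_le_cols]). *)

(** * Entrywise order and greedy saturation *)

Lemma increasingP (a b : nat) (f : {ffun 'I_a -> 'I_b}) :
  reflect (forall i j : 'I_a, i < j -> f i < f j) (increasing f).
Proof.
apply: (iffP forallP) => [f_inc i j | f_inc i].
  by move: (f_inc i) => /forallP/(_ j)/implyP.
by apply/forallP => j; apply/implyP/f_inc.
Qed.

Lemma containsP (m n k l : nat) (M : 'M[bool]_(m, n)) (P : 'M[bool]_(k, l)) :
  reflect (exists f : {ffun 'I_k -> 'I_m}, exists g : {ffun 'I_l -> 'I_n},
             [/\ increasing f, increasing g &
                 forall i j, P i j -> M (f i) (g j)])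
          (contains M P).
Proof.
apply: (iffP existsP) => [[f /existsP[g /and3P[f_inc g_inc MP]]] | [f [g []]]].
  exists f, g; split=> // i j Pij.
  by move: MP => /forallP/(_ i)/forallP/(_ j); rewrite Pij mxE.
move=> f_inc g_inc MP; exists f; apply/existsP; exists g; apply/and3P; split=> //.
apply/forallP => i; apply/forallP => j; apply/implyP => Pij.
by rewrite mxE; apply: MP.
Qed.

Lemma contains_mono (m n k l : nat) (M N : 'M[bool]_(m, n))
    (P : 'M[bool]_(k, l)) :
  (forall i j, M i j -> N i j) -> contains M P -> contains N P.
Proof.
move=> MN /containsP[f [g [f_inc g_inc MP]]].
by apply/containsP; exists f, g; split=> // i j /MP/MN.
Qed.

(** A heaviest [P]-free matrix above [M] is saturated; outside [S] it has no
    ones, since a single one added there to [M] already creates [P]. *)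
Lemma sat_le_cols (m n k l : nat) (P : 'M[bool]_(k, l)) (M : 'M[bool]_(m, n))
    (S : {set 'I_n}) :
  ~~ contains M P ->
  (forall i j, j \notin S -> contains (set_one M i j) P) ->
  sat m n P <= m * #|S|.
Proof.
move=> MP MS.
pose above (N : 'M[bool]_(m, n)) :=
  ~~ contains N P && [forall i, forall j, M i j ==> N i j].
have aboveM : above M.
  by rewrite /above MP; apply/forallP => i; apply/forallP => j; apply/implyP.
have [N /andP[NP /forallP MN] maxN] := @arg_maxnP _ _ above (@weight m n) aboveM.
have {}MN i j : M i j -> N i j by apply/implyP; move: j; apply/forallP/MN.
have satN : saturated P N.
  rewrite /saturated NP; apply/forallP => a; apply/forallP => b.
  apply/implyP => Nab; apply: contraT => N1P.
  have /maxN : above (set_one N a b).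
    rewrite /above N1P; apply/forallP => i; apply/forallP => j; apply/implyP.
    by move=> /MN Nij; rewrite mxE Nij orbT.
  rewrite /= leqNgt => /negP[]; apply: proper_card; apply/properP; split.
    by apply/subsetP => ij; rewrite !inE mxE => ->; rewrite orbT.
  by exists (a, b); rewrite inE ?mxE ?eqxx.
apply: leq_trans (sat_le satN) _.
rewrite -[m in m * _]card_ord -cardsT -cardsX; apply: subset_leq_card.
apply/subsetP => -[i j]; rewrite !inE /= => Nij.
apply: contraT => /(MS i) /contains_mono MS1; case/negP: NP; apply: MS1 => i' j'.
by rewrite mxE => /orP[/eqP[-> ->] | /MN].
Qed.

(** * Moving columns apart *)

(** Column [a] of [M] becomes column [h a]; all other columns are empty. *)
Definition spread (m n n' : nat) (h : 'I_n -> 'I_n') (M : 'M[bool]_(m, n)) :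
    'M[bool]_(m, n') :=
  \matrix_(i, x) [exists a, (h a == x) && M i a].

Definition spaced (d n n' : nat) (h : 'I_n -> 'I_n') : Prop :=
  [/\ forall a, d <= h a, forall a, h a + d <= n' &
      forall a b : 'I_n, a < b -> h a + d <= h b].

Lemma spread_set_one (m n n' : nat) (h : 'I_n -> 'I_n') (M : 'M[bool]_(m, n))
    (i : 'I_m) (c : 'I_n) :
  spread h (set_one M i c) = set_one (spread h M) i (h c).
Proof.
apply/matrixP => i' x; rewrite !mxE.
apply/existsP/orP => [[a /andP[/eqP <-]] | [/eqP[-> ->] | /existsP[a /andP[hx Ma]]]].
- rewrite mxE => /orP[/eqP[-> ->] | Ma]; [by left | right].
  by apply/existsP; exists a; rewrite eqxx.
- by exists c; rewrite mxE !eqxx.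
- by exists a; rewrite hx mxE Ma orbT.
Qed.

Lemma eq_spread (m n n' : nat) (h h' : 'I_n -> 'I_n') (M : 'M[bool]_(m, n))
    (c : 'I_n) :
  empty_col M c -> (forall a, a != c -> h a = h' a) -> spread h M = spread h' M.
Proof.
move=> /forallP Mc hh'; apply/matrixP => i x; rewrite !mxE; apply: eq_existsb => a.
by have [->|/hh'->//] := eqVneq a c; rewrite (negPf (Mc i)) !andbF.
Qed.

(** Every column of [P] has a one, so a copy of [P'] places the columns coming
    from [P] on nonempty columns of the spread matrix, all of which come from
    [M]. *)
Lemma spread_contains (m n n' k l l' : nat) (h : 'I_n -> 'I_n')
    (M : 'M[bool]_(m, n)) (P : 'M[bool]_(k, l)) (P' : 'M[bool]_(k, l')) :
  (forall a b : 'I_n, a < b -> h a < h b) ->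
  (forall j, ~~ empty_col P j) -> adds_empty_cols P P' ->
  contains (spread h M) P' -> contains M P.
Proof.
move=> h_inc P_cols [G [/increasingP G_inc defP _]].
move=> /containsP[f [g' [f_inc /increasingP g'_inc MP']]].
have h_lt (a b : 'I_n) : h a < h b -> a < b.
  case: (ltngtP a b) => // [/h_inc|/val_inj->]; lia.
have h_inj (a b : 'I_n) : h a = h b -> a = b.
  move=> hab; case: (ltngtP a b) => [/h_inc|/h_inc|/val_inj //]; rewrite hab; lia.
have PM i u : P i u -> exists2 a, h a = g' (G u) & M (f i) a.
  rewrite -defP mxE => /MP'; rewrite mxE => /existsP[a /andP[/eqP ha Ma]].
  by exists a.
have ex_g u : exists a, h a == g' (G u).
  move: (P_cols u); rewrite negb_forall => /existsP[i]; rewrite negbK.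
  by move=> /PM[a ha _]; exists a; apply/eqP.
pose g := [ffun u => xchoose (ex_g u)].
have hg u : h (g u) = g' (G u) by rewrite ffunE; apply/eqP/(xchooseP (ex_g u)).
apply/containsP; exists f, g; split=> //.
  by apply/increasingP => u v uv; apply: h_lt; rewrite !hg; apply/g'_inc/G_inc.
by move=> i u /PM[a]; rewrite -hg => /h_inj->.
Qed.

(** The new columns are placed directly to the right of their predecessor, so
    column [v] goes to [v] plus the largest shift [q u - G u] of an old column
    [u] up to [v]; these shifts grow with [u], which makes the result both
    increasing and equal to [q] on old columns. *)
Lemma extend_spaced (l l' n : nat) (G : {ffun 'I_l -> 'I_l'})
    (q : 'I_l -> 'I_n) :
  increasing G -> l' <= n -> spaced l' q ->
  exists2 g : {ffun 'I_l' -> 'I_n}, increasing g & forall u, g (G u) = q u.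
Proof.
move=> /increasingP G_inc l'n [q_lo q_hi q_gap].
pose t (v : 'I_l') := \max_(u | G u <= v) (q u - G u).
have t_lt (v : 'I_l') : t v + v < n.
  rewrite /t; elim/big_ind: _ => [|x y xn yn|u Guv].
  - by have := ltn_ord v; lia.
  - by case: (leqP x y).
  - by have := (q_lo u, q_hi u, ltn_ord v, ltn_ord (G u)) => -[[[]]]; lia.
have t_le (v w : 'I_l') : v <= w -> t v <= t w.
  move=> vw; apply/bigmax_leqP => u Guv.
  by apply: (@leq_bigmax_cond _ _ (fun u => q u - G u)); apply: leq_trans vw.
exists [ffun v => Ordinal (t_lt v)].
  apply/increasingP => v w vw; rewrite !ffunE /=.
  by have := t_le v w (ltnW vw); lia.
move=> u; apply: val_inj; rewrite ffunE /=.
suff -> : t (G u) = q u - G u by have := (q_lo u, ltn_ord (G u)) => -[]; lia.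
apply/eqP; rewrite eqn_leq (@leq_bigmax_cond _ _ (fun u => q u - G u)) // andbT.
apply/bigmax_leqP => w Gwu; case: (ltngtP w u) => [wu|/G_inc|/val_inj-> //].
  have := (q_gap w u wu, q_lo w, ltn_ord (G w), ltn_ord (G u)).
  by move=> -[[[]]]; lia.
by lia.
Qed.

Lemma contains_spread (m n n' k l l' : nat) (h : 'I_n -> 'I_n')
    (M : 'M[bool]_(m, n)) (P : 'M[bool]_(k, l)) (P' : 'M[bool]_(k, l')) :
  l' <= n' -> spaced l' h -> adds_empty_cols P P' ->
  contains M P -> contains (spread h M) P'.
Proof.
move=> l'n' [h_lo h_hi h_gap] [G [G_inc defP P'0]].
move=> /containsP[f [g [f_inc /increasingP g_inc MP]]].
have [|g' g'_inc g'G] := @extend_spaced l l' n' G (h \o g) G_inc l'n'.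
  by split=> [u|u|u v uv]; [apply: h_lo | apply: h_hi | apply/h_gap/g_inc].
apply/containsP; exists f, g'; split=> // i v P'iv.
have [/codomP[u def_v]|/P'0/forallP/(_ i)] := boolP (v \in codom G); last first.
  by rewrite P'iv.
rewrite def_v g'G mxE; apply/existsP; exists (g u); rewrite eqxx /=.
by apply: MP; rewrite -defP mxE -def_v.
Qed.

(** * Placing the columns around a movable one *)

(** Columns before [c] are packed to the left and those after [c] to the right,
    at distance [d] from each other and from the border; column [c] goes to
    [j]. When [0 < d] and [j] is in the movable range, these positions all
    fit in the width and the default value of [insubd] is not used. *)
Definition place (d n n' : nat) (c : 'I_n) (j : 'I_n') (a : 'I_n) : 'I_n' :=
  insubd j (if a < c then a.+1 * d
            else if c < a then n' - (n - a) * d else j : nat).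

Definition movable_range (d n n' : nat) (c : 'I_n) (j : 'I_n') : bool :=
  (c.+1 * d <= j) && (j + (n - c) * d <= n').

Lemma val_place (d n n' : nat) (c : 'I_n) (j : 'I_n') (a : 'I_n) :
  0 < d -> movable_range d c j ->
  place d c j a = (if a < c then a.+1 * d
                        else if c < a then n' - (n - a) * d else j : nat) :> nat.
Proof.
move=> d_gt0 /andP[cj jn]; rewrite val_insubd; case: ifP => // /negP[].
have jn' := ltn_ord j; have an := ltn_ord a.
case: (ltnP a c) => [ac|_]; first by nia.
by case: (ltnP c a) => // ca; nia.
Qed.

Lemma place_spaced (d n n' : nat) (c : 'I_n) (j : 'I_n') :
  0 < d -> movable_range d c j -> spaced d (place d c j).
Proof.
move=> d_gt0 jc; have /andP[cj jn] := jc.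
split=> [a|a|a b ab]; rewrite !val_place //.
- have an := ltn_ord a; case: (ltnP a c) => ?; first by nia.
  by case: (ltnP c a) => ?; nia.
- have an := ltn_ord a; case: (ltnP a c) => ?; first by nia.
  by case: (ltnP c a) => ?; nia.
- have bn := ltn_ord b; case: (ltnP b c) => ?.
    by case: (ltnP a c) => ?; nia.
  by case: (ltnP a c) => ?; case: (ltnP c b) => ?; case: (ltnP c a) => ?; nia.
Qed.

Lemma place_id (d n n' : nat) (c : 'I_n) (j : 'I_n') : place d c j c = j.
Proof. by apply: val_inj; rewrite val_insubd ltnn ltn_ord. Qed.

Lemma eq_place (d n n' : nat) (c : 'I_n) (j j' : 'I_n') (a : 'I_n) :
  0 < d -> movable_range d c j -> movable_range d c j' ->
  a != c -> place d c j a = place d c j' a.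
Proof.
move=> d_gt0 jc j'c; rewrite -val_eqE => ac; apply: val_inj; rewrite /= !val_place //.
by case: ltngtP ac.
Qed.

Lemma card_not_movable (d n n' : nat) (c : 'I_n) :
  #|[set j : 'I_n' | ~~ movable_range d c j]| <= n.+1 * d.
Proof.
case: n' => [|n'] in c *.
  by rewrite (leq_trans (max_card _)) // card_ord.
(* [F] runs through the positions too far left for [c], then through the at
     most [(n - c) * d] ones too far right, from the right border inwards. *)
pose F (z : 'I_(n.+1 * d)) : 'I_n'.+1 :=
  if z < c.+1 * d then inord z else inord (n' - (z - c.+1 * d)).
apply: leq_trans (_ : #|F @: setT| <= _); last first.
  by rewrite (leq_trans (leq_imset_card _ _)) // cardsT card_ord.
apply: subset_leq_card; apply/subsetP => j; rewrite inE negb_and -!ltnNge => jout.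
have jn := ltn_ord j; have cn := ltn_ord c.
have [jc|cj] := ltnP j (c.+1 * d).
  have zlt : j < n.+1 * d by nia.
  apply/imsetP; exists (Ordinal zlt); rewrite // /F /= jc.
  by apply: val_inj; rewrite /= inordK.
have zlt : n' - j + c.+1 * d < n.+1 * d.
  by move: jout; rewrite ltnNge cj /=; nia.
apply/imsetP; exists (Ordinal zlt); rewrite // /F /= ltnNge leq_addl /= addnK.
by apply: val_inj; rewrite /= inordK; lia.
Qed.

(** * Bounded saturation *)

Lemma light_empty_col (m n : nat) (M : 'M[bool]_(m, n)) :
  weight M < n -> exists c, empty_col M c.
Proof.
move=> Mn; apply/existsP; apply: contraLR Mn; rewrite -leqNgt negb_exists.
move=> /forallP Mcols; rewrite -[n in n <= _]card_ord -cardsT.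
apply: leq_trans (leq_imset_card snd _); apply: subset_leq_card.
apply/subsetP => j _; move: (Mcols j); rewrite negb_forall => /existsP[i].
by rewrite negbK => Mij; apply/imsetP; exists (i, j); rewrite ?inE.
Qed.

(** The bound comes from a single saturated matrix with an empty column, spread
    out to all widths. *)
Lemma sat_le_of_empty_col (m n n' k l l' : nat) (P : 'M[bool]_(k, l))
    (P' : 'M[bool]_(k, l')) (M : 'M[bool]_(m, n)) (c : 'I_n) :
  0 < l' -> (forall j, ~~ empty_col P j) -> adds_empty_cols P P' ->
  saturated P M -> empty_col M c -> n.+1 * l' < n' ->
  sat m n' P' <= m * (n.+1 * l').
Proof.
move=> l'_gt0 P_cols P'P /andP[MP /forallP M1P] Mc n'_large.
have cn := ltn_ord c; have j0n : c.+1 * l' < n' by nia.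
have j0c : movable_range l' c (Ordinal j0n).
  by rewrite /movable_range leqnn /=; nia.
pose h := place l' c (Ordinal j0n).
have [_ _ h_gap] := place_spaced l'_gt0 j0c.
apply: leq_trans (_ : m * #|[set j : 'I_n' | ~~ movable_range l' c j]| <= _).
  apply: (@sat_le_cols _ _ _ _ _ (spread h M)).
    apply: contra MP; apply: spread_contains => // a b /h_gap.
    by apply: leq_trans; rewrite -addn1 leq_add2l.
  move=> i j; rewrite inE negbK => jc.
  (* Column [c] is empty, so it can be moved to [j], where the new one is. *)
  have -> : spread h M = spread (place l' c j) M.
    by apply: eq_spread Mc _ => a; apply: eq_place.
  rewrite -{2}(place_id l' c j) -spread_set_one.
  apply: contains_spread P'P _; [by nia | exact: place_spaced |].
  by move: (M1P i) (Mc) => /forallP/(_ c)/implyP M1 /forallP/(_ i)/M1.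
by rewrite leq_mul2l card_not_movable orbT.
Qed.

Theorem proposition4p5 (k l l' m0 : nat)
    (P : 'M[bool]_(k, l)) (P' : 'M[bool]_(k, l'))
    (k_gt0 : 0 < k) (l_gt0 : 0 < l) (m0_gt0 : 0 < m0)
    (P_cols : forall j : 'I_l, ~~ empty_col P j)
    (P'P : adds_empty_cols P P') :
  bigO1 (fun n => sat m0 n P) -> bigO1 (fun n => sat m0 n P').
Proof.
move=> [C [N satC]]; pose n := maxn N C.+1.
have P1 : exists i j, P i j.
  move: (P_cols (Ordinal l_gt0)); rewrite negb_forall => /existsP[i].
  by rewrite negbK; exists i, (Ordinal l_gt0).
have [M0 /sat_attained[M satM wM]] := saturated_exists m0 n P1.
have [c Mc] : exists c, empty_col M c.
  apply: light_empty_col; rewrite wM; apply: leq_ltn_trans (satC n _) _.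
    exact: leq_maxl.
  exact: leq_maxr.
have l'_gt0 : 0 < l'.
  by have [G _] := P'P; exact: leq_ltn_trans (ltn_ord (G (Ordinal l_gt0))).
exists (m0 * (n.+1 * l')), (n.+1 * l').+1 => n' n'_large.
exact: sat_le_of_empty_col P_cols P'P satM Mc n'_large.
Qed.
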